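(* For every integer $n\ge 0$, \[ \sum_{k=-\infty}^{\infty}(-1)^k\,\overline{p}_o\!\left(n-\frac{k(3k+1)}{2}\right)=\begin{cases}(-1)^{\lceil m/2\rceil}, & \text{if } n=\frac{m(3m+1)}{2} \text{ for some } m\in\mathbb{Z},\\ 0, & \text{otherwise}.\end{cases} \]
   Context: An overpartition of a nonnegative integer $n$ is a partition of $n$ in which the first occurrence of each part size may be overlined. $\overline{p}_o(n)$ denotes the number of overpartitions of $n$ into odd parts; equivalently $\sum_{n\ge0}\overline{p}_o(n)q^n=\frac{(-q;q^2)_\infty}{(q;q^2)_\infty}$, where $(a;q)_\infty=\prod_{k\ge1}(1-aq^{k-1})$. Convention: $\overline{p}_o(x)=0$ whenever $x$ is not a nonnegative integer. *)

(* Defs.v *)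
From mathcomp Require Import all_boot all_order all_algebra.
From mathcomp Require Import boolp classical_sets cardinality fsbigop.
From mathcomp Require Import zify.

Set Implicit Arguments.
Unset Strict Implicit.
Unset Printing Implicit Defensive.

Import Order.TTheory GRing.Theory Num.Theory.
Local Open Scope ring_scope.

(* An overpartition is the list of its parts in nonincreasing order of size;
   each part is a pair (size, overlined?).  Only the first occurrence of a size
   may carry the flag [true], so each overpartition has exactly one such list. *)
Definition is_overpartition (n : nat) (s : seq (nat * bool)) : bool :=
  [&& all (fun a => 0 < a)%N (unzip1 s),
      sorted geq (unzip1 s),
      sumn (unzip1 s) == n
    & all (fun i => (nth (0, false)%N s i).2 ==>
                    ((nth (0, false)%N s i).1 \notin take i (unzip1 s)))
          (iota 0 (size s))].

Definition odd_parts (s : seq (nat * bool)) : bool := all odd (unzip1 s).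

(* An overpartition of n has at most n parts, each of size at most n, so the
   lists in the finite type {bseq n of 'I_n.+1 * bool} exhaust them; see
   [overpartition_bounded]. *)
Definition bounded_seq (n : nat) (s : {bseq n of 'I_n.+1 * bool}) :
    seq (nat * bool) :=
  [seq (nat_of_ord a.1, a.2) | a <- s].

Definition pbar_odd (n : nat) : nat :=
  #|[set s : {bseq n of 'I_n.+1 * bool} |
      is_overpartition n (bounded_seq s) && odd_parts (bounded_seq s)]|.

Definition pbar_oddz (z : int) : nat :=
  if z is Posz n then pbar_odd n else 0%N.

(* The division is exact, see [dvd2_pentagonal]. *)
Definition pentagonal (k : int) : int := (k * (3 * k + 1) %/ 2)%Z.

Lemma bounded_seq_inj n : injective (@bounded_seq n).
Proof.
move=> s t /inj_map e; apply: val_inj; apply: e.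
by move=> [i b] [j c] /= [/val_inj -> ->].
Qed.

Lemma overpartition_bounded n s :
  is_overpartition n s -> exists t : {bseq n of 'I_n.+1 * bool}, bounded_seq t = s.
Proof.
case/and4P=> pos _ /eqP sum _.
have szle : (size s <= n)%N.
  rewrite -sum; elim: s pos {sum} => //= a s IH /andP[a0 /IH]; lia.
have le : forall a, a \in s -> (a.1 < n.+1)%N.
  move=> a; rewrite -sum; elim: s {pos sum szle} => //= b s IH.
  rewrite inE => /orP[/eqP->|/IH]; lia.
have sz : (size [seq (inord a.1 : 'I_n.+1, a.2) | a <- s] <= n)%N.
  by rewrite size_map.
exists (Bseq sz); rewrite /bounded_seq /= -map_comp.
rewrite -[RHS]map_id; apply/eq_in_map => -[a b] /le /= ha.
by rewrite inordK.
Qed.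

Lemma dvd2_pentagonal (k : int) : (2 %| k * (3 * k + 1))%Z.
Proof.
have -> : k * (3 * k + 1) = (k * (k + 1)) + 2 * (k * k) by lia.
have [q [->|->]] : exists q : int, k = 2 * q \/ k = 2 * q + 1.
  by exists (k %/ 2)%Z; lia.
all: apply/dvdzP.
  by exists (q * (2 * q + 1) + 4 * (q * q)); lia.
by exists ((2 * q + 1) * (q + 1) + (2 * q + 1) * (2 * q + 1)); lia.
Qed.

Lemma pentagonal_sum_finite (n : nat) :
  finite_set [set k : int |
    (-1) ^ k * (pbar_oddz (n%:Z - pentagonal k))%:Z != 0]%classic.
Proof.
pose l : seq int := [seq i%:Z - n.+1%:Z | i <- iota 0 (2 * n + 3)].
apply: (sub_finite_set _ (finite_seq l)) => /= k.
rewrite /mkset /= mulf_eq0 negb_or => /andP[_ nz].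
have : 0 <= n%:Z - pentagonal k.
  by move: nz; rewrite /pbar_oddz; case: (_ - _) => // m; rewrite eqxx.
have := divzK (dvd2_pentagonal k); rewrite -/(pentagonal k).
move: (pentagonal k) => p ep le.
apply/mapP; exists (absz ((k : int) + n.+1%:Z)); last by nia.
by rewrite mem_iota; nia.
Qed.

(* Main.v *)
(* Write A(q) = (q;q)_oo.  By Euler's pentagonal number theorem the alternating
   sum is the coefficient of q^n in
     A(q) (-q;q^2)_oo / (q;q^2)_oo = (q^2;q^2)_oo (-q;q^2)_oo = A(-q),
   and a second use of the theorem gives (-1)^(m + n) when n = m(3m+1)/2.
   The pentagonal number theorem comes from Shanks' finite identity [shanks],
   whose left-hand side agrees with (q;q)_n up to degree n.  Power series are
   replaced by polynomials over int compared up to degree n. *)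

Require Import Defs.
From mathcomp Require Import all_boot all_order all_algebra.
From mathcomp Require Import boolp classical_sets cardinality fsbigop.
From mathcomp Require Import zify ring.

Set Implicit Arguments.
Unset Strict Implicit.
Unset Printing Implicit Defensive.

Import Order.TTheory GRing.Theory Num.Theory.
Local Open Scope ring_scope.

(** * Recursive enumeration of overpartitions into odd parts *)

(* With sizes in nonincreasing order, "only a first occurrence is overlined"
   says that a part of size a is followed by a part of code at most 2a. *)
Definition part_code (x : nat * bool) : nat := (x.1.*2 + x.2)%N.

Fixpoint oddover (c n : nat) (s : seq (nat * bool)) : bool :=
  if s is x :: s' then
    [&& part_code x <= c, odd x.1, x.1 <= n & oddover x.1.*2 (n - x.1) s']%N
  else n == 0%N.

Definition first_overlined (s : seq (nat * bool)) : bool :=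
  all (fun i => (nth (0, false)%N s i).2 ==>
                ((nth (0, false)%N s i).1 \notin take i (unzip1 s)))
      (iota 0 (size s)).

(** The head is always a first occurrence, so its flag is free; it only forbids overlining later
    parts of the same size. *)
Lemma first_overlined_cons x s :
  first_overlined (x :: s) =
  all (fun y => y.2 ==> (y.1 != x.1)) s && first_overlined s.
Proof.
rewrite /first_overlined /= implybT /= -[1%N]addn0 iotaDl all_map.
have -> : all (fun y => y.2 ==> (y.1 != x.1)) s =
    all (fun i => (nth (0, false)%N s i).2 ==> ((nth (0, false)%N s i).1 != x.1))
        (iota 0 (size s)).
  by rewrite -[in LHS](mkseq_nth (0, false)%N s) all_map.
rewrite -all_predI; apply: eq_all => i /=.
by rewrite inE negb_or; case: (nth _ s i).2.
Qed.

Lemma oddoverE c n s :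
  oddover c n s =
  [&& all (fun x => part_code x <= c)%N s, odd_parts s,
      sorted geq (unzip1 s), sumn (unzip1 s) == n & first_overlined s].
Proof.
elim: s c n => [|x s IH] c n /=; first by rewrite andbT eq_sym.
rewrite IH first_overlined_cons (path_sortedE (rev_trans leq_trans)).
have -> : odd_parts (x :: s) = odd x.1 && odd_parts s by [].
have -> : (x.1 + sumn (unzip1 s) == n)%N
        = (x.1 <= n)%N && (sumn (unzip1 s) == n - x.1)%N by lia.
have [ox|] := boolP (odd x.1); last by rewrite !andbF.
have [lx|] := boolP (x.1 <= n)%N; last by rewrite !andbF.
have [cx|] := boolP (part_code x <= c)%N; last by [].
rewrite !andTb.
(* The single bound on codes encodes both the ordering of sizes and the ban on overlining a repeated
   size; the bound by [c] is inherited from [x]. *)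
have -> : all (fun y => part_code y <= x.1.*2)%N s =
   [&& all (fun y => part_code y <= c)%N s,
       all (geq x.1) (unzip1 s)
     & all (fun y => y.2 ==> (y.1 != x.1)) s].
  rewrite all_map -!all_predI; apply: eq_all => -[a b] /=.
  by move: cx; rewrite /part_code /=; case: b; lia.
case: (all _ s); case: (all _ (unzip1 s)); case: (all _ s); case: (odd_parts s);
  by rewrite ?andbF ?andbT.
Qed.

(** Parts of size at most [n] have code at most 2n + 1, so such a [c] imposes no restriction. *)
Lemma oddover_overpartition c n s : (n.*2 < c)%N ->
  is_overpartition n s && odd_parts s = oddover c n s.
Proof.
move=> nc; rewrite oddoverE /is_overpartition -/(first_overlined s).
apply/andP/and5P => [[/and4P[h1 h2 h3 h4] h5]|[h1 h2 h3 h4 h5]]; split => //.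
  apply/allP => x xs; have : (x.1 <= n)%N.
    rewrite -(eqP h3); elim: s xs {h1 h2 h3 h4 h5} => //= y s IH.
    by rewrite inE => /orP[/eqP->|/IH]; lia.
  move: x {xs} => [a b] /=; clear -nc => an; rewrite /part_code /=.
  by case: b => /=; lia.
(* Odd parts are positive. *)
by apply/and4P; split=> //; apply: sub_all h2 => a; case: a.
Qed.

(* [f] is fuel: the enumeration is complete as soon as [n + c < f]. *)
Fixpoint enum_oddover (f c n : nat) : seq (seq (nat * bool)) :=
  if f is f'.+1 then
    if (c < 2)%N then nseq (n == 0%N) [::] else
    enum_oddover f' c.-1 n ++
    (if odd c./2 && (c./2 <= n)%N then
       [seq (c./2, odd c) :: s | s <- enum_oddover f' c./2.*2 (n - c./2)]
     else [::])
  else [::].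

Lemma mem_enum_oddover f c n s : (n + c < f)%N ->
  (s \in enum_oddover f c n) = oddover c n s.
Proof.
elim: f c n s => //= f IH c n s nf.
case: ifP => c2.
  case: s => [|[a b] s] /=; first by case: (n == 0%N).
  (* An odd part has code at least 2, so only the empty list remains. *)
  have nab : (part_code (a, b) <= c)%N && odd a = false.
    by rewrite /part_code /=; lia.
  by rewrite andbA nab; case: (n == 0%N).
rewrite mem_cat IH; last by lia.
have -> : (s \in if odd c./2 && (c./2 <= n)%N then
            [seq (c./2, odd c) :: s0 | s0 <- enum_oddover f c./2.*2 (n - c./2)]
            else [::])
  = if s is x :: s' then
      [&& part_code x == c, odd x.1, x.1 <= n & oddover x.1.*2 (n - x.1) s']%N
    else false.
  case: ifP => cn.
    case: s => [|[a b] s] /=; first by apply/mapP => -[].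
    apply/mapP/idP => [[s' + [-> -> ->]]|].
      rewrite IH; last by lia.
      by case/andP: cn => -> -> ->; rewrite /part_code /=; lia.
    case/and4P; rewrite /part_code /= => /eqP e oa an h.
    have ea : a = c./2 by lia.
    have eb : b = odd c by lia.
    by subst a b; exists s => //; rewrite IH //; lia.
  case: s => [|[a b] s] //=; rewrite /part_code /=.
  apply/esym/negbTE/negP => /and4P[/eqP e oa an _].
  have ea : c./2 = a by lia.
  by rewrite ea oa an in cn.
case: s => [|x s] /=; first by rewrite orbF.
rewrite -andb_orl; congr (_ && _); lia.
Qed.

Lemma enum_oddover_uniq f c n : (n + c < f)%N -> uniq (enum_oddover f c n).
Proof.
elim: f c n => //= f IH c n nf.
case: ifP => c2; first by case: (n == 0%N).
rewrite cat_uniq IH; last by lia.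
case: ifP => cn //=; rewrite map_inj_uniq; last by move=> s t [].
rewrite IH ?andbT; last by lia.
apply/hasPn => s /mapP [t _ ->].
rewrite mem_enum_oddover; last by lia.
by rewrite /= /part_code /=; apply/negP => /andP[]; lia.
Qed.

Definition num_oddover c n := size (enum_oddover (n + c).+1 c n).

Lemma num_oddoverE f c n : (n + c < f)%N ->
  size (enum_oddover f c n) = num_oddover c n.
Proof.
move=> nf; apply/perm_size/uniq_perm; rewrite ?enum_oddover_uniq // => s.
by rewrite !mem_enum_oddover.
Qed.

Lemma num_oddover_small c n : (c < 2)%N -> num_oddover c n = (n == 0)%N.
Proof. by move=> c2; rewrite /num_oddover /= c2 size_nseq. Qed.

(** Split on whether the first part has code exactly [c], that is, size [c./2] and overlined iff [c]
    is odd. *)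
Lemma num_oddover_rec c n : (1 < c)%N ->
  num_oddover c n = (num_oddover c.-1 n +
    if odd c./2 && (c./2 <= n) then num_oddover c./2.*2 (n - c./2) else 0)%N.
Proof.
move=> c2; rewrite {1}/num_oddover /= ltnNge c2 /= size_cat num_oddoverE; last lia.
by case: ifP => // h; rewrite size_map num_oddoverE //; lia.
Qed.

Lemma pbar_odd_num c n : (n.*2 < c)%N -> pbar_odd n = num_oddover c n.
Proof.
move=> nc; rewrite /pbar_odd cardE -(size_map (@bounded_seq n)).
apply/perm_size/uniq_perm; rewrite ?enum_oddover_uniq //.
  by rewrite map_inj_uniq ?enum_uniq //; exact: bounded_seq_inj.
move=> s; rewrite mem_enum_oddover // -oddover_overpartition //.
apply/mapP/idP => [[t + ->]|h]; first by rewrite mem_enum inE.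
have [t et] : exists t : {bseq n of 'I_n.+1 * bool}, bounded_seq t = s.
  by apply: overpartition_bounded; case/andP: h.
by exists t; rewrite // mem_enum inE et.
Qed.

(** * Pentagonal numbers and their signs *)

Lemma pentagonalE (k : int) : 2 * pentagonal k = k * (3 * k + 1).
Proof. by rewrite mulrC /pentagonal divzK // dvd2_pentagonal. Qed.

Lemma pentagonal_ge0 k : 0 <= pentagonal k.
Proof. by have := pentagonalE k; nia. Qed.

Lemma pentagonal_inj : injective pentagonal.
Proof.
move=> k l e; have := pentagonalE k; rewrite e pentagonalE => {}e.
(* The second factor is 1 modulo 3, hence nonzero. *)
have : (k - l) * (3 * (k + l) + 1) == 0 by apply/eqP; lia.
by rewrite mulf_eq0 => /orP[] /eqP; lia.
Qed.

Lemma ler_abs_pentagonal k : `|k| <= pentagonal k.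
Proof. by have := pentagonalE k; nia. Qed.

Lemma sqr_exprN1z (k : int) : (-1 : int) ^ (k * 2) = 1.
Proof. by rewrite mulrC -exprz_exp exp1rz. Qed.

Lemma exprN1z_eq (k l t : int) : k = l + t * 2 -> (-1 : int) ^ k = (-1) ^ l.
Proof. by move=> ->; rewrite exprzDr ?unitrN1 // sqr_exprN1z mulr1. Qed.

Lemma ceil_half (q : int) (b : bool) :
  Num.ceil ((2 * q + b%:Z)%:Q / 2) = q + b%:Z.
Proof.
apply: ceil_def; rewrite ltr_pdivlMr // ler_pdivrMr //.
have e2 : (2 : rat) = 2%:~R by []; rewrite {}e2.
by rewrite -!intrM ltr_int ler_int; case: b; lia.
Qed.

Lemma pentagonal_sign (m : int) :
  (-1 : int) ^ m * (-1) ^ pentagonal m = (-1) ^ Num.ceil (m%:Q / 2).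
Proof.
rewrite -exprzDr ?unitrN1 //; have := pentagonalE m.
have [q [b ->]] : exists q (b : bool), m = 2 * q + b%:Z.
  by exists (m %/ 2)%Z, (m %% 2 == 1)%Z; lia.
rewrite ceil_half => e.
(* Each witness is half the difference between [m + pentagonal m] and the ceiling of m/2. *)
case: b e => /= e.
  by apply: (@exprN1z_eq _ _ (3 * q * q + 4 * q + 1)); nia.
by apply: (@exprN1z_eq _ _ (3 * q * q + q)); nia.
Qed.

(** * Shanks' finite form of the pentagonal number theorem *)

(** Built so that one induction step in [shanks] adds exactly the indices n + 1 and -(n + 1). *)
Fixpoint zball (n : nat) : seq int :=
  if n is n'.+1 then [:: n%:Z, - n%:Z & zball n'] else [:: 0].

Lemma mem_zball n k : (k \in zball n) = (`|k| <= n%:Z).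
Proof. by elim: n => [|n IH]; rewrite !inE ?IH; lia. Qed.

Lemma zball_uniq n : uniq (zball n).
Proof. by elim: n => //= n ->; rewrite !inE !mem_zball; lia. Qed.

Definition pent (k : int) : nat := absz (pentagonal k).

Lemma pentE k : (pent k)%:Z = pentagonal k.
Proof. by rewrite /pent gez0_abs ?pentagonal_ge0. Qed.

Definition euler_sum (n : nat) : {poly int} :=
  \sum_(k <- zball n) ((-1) ^ k) *: 'X^(pent k).

Definition euler_prod (n : nat) : {poly int} :=
  \prod_(1 <= j < n.+1) (1 - 'X^j).

(** The product is the quotient of (q;q)_n by (q;q)_s, written without division. *)
Definition shanks_term (n s : nat) : {poly int} :=
  (-1) ^+ s * (\prod_(s.+1 <= j < n.+1) (1 - 'X^j)) * 'X^(s * n + 'C(s.+1, 2)).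

Lemma shanks_termS n s : (s <= n)%N ->
  shanks_term n.+1 s = shanks_term n s * 'X^s * (1 - 'X^(n.+1)).
Proof.
move=> sn; rewrite /shanks_term big_nat_recr //= mulnS -addnA exprD.
by rewrite [in RHS]exprD exprD; ring.
Qed.

Lemma shanks_term_shift n s : (s < n)%N ->
  shanks_term n s.+1 * (1 - 'X^(s.+1)) = - (shanks_term n s * 'X^(s + n.+1)).
Proof.
move=> sn; rewrite /shanks_term (@big_ltn _ _ _ s.+1) //=.
rewrite binS bin1 mulSn exprS.
have -> : (n + s * n + ('C(s.+1, 2) + s.+1) = s * n + 'C(s.+1, 2) + (s + n.+1))%N
  by lia.
by rewrite exprD; ring.
Qed.

(* With 'X^s = 1 - (1 - 'X^s) in [shanks_termS], everything cancels against
   [shanks_term_shift] except two terms, the pentagonal monomials. *)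
Lemma shanks n : \sum_(s < n.+1) shanks_term n s = euler_sum n.
Proof.
elim: n => [|n IH].
  rewrite big_ord_recl big_ord0 /euler_sum big_seq1 /shanks_term big_geq //.
  by rewrite /= expr0 expr0z scale1r addr0 !mul1r.
rewrite big_ord_recr /= /euler_sum /= !big_cons -/(euler_sum n) -IH.
have -> : \sum_(s < n.+1) shanks_term n.+1 s =
  \sum_(s < n.+1) shanks_term n s
  - \sum_(s < n.+1) shanks_term n s * (1 - 'X^s)
  - \sum_(s < n.+1) shanks_term n s * 'X^(s + n.+1).
  rewrite -!sumrB; apply: eq_bigr => s _.
  rewrite shanks_termS; last by rewrite -ltnS.
  by rewrite exprD; ring.
rewrite [\sum_(s < n.+1) _ * (1 - 'X^s)]big_ord_recl /= expr0 subrr mulr0 add0r.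
under [\sum_(i < n) _]eq_bigr => s _ do rewrite /bump /= add1n shanks_term_shift //.
rewrite [X in _ - _ - X]big_ord_recr /= sumrN opprK opprD addrA addrK.
rewrite -addrA addrC addrA; congr (_ + _).
(* The two survivors: [e1] is the exponent of the new term s = n + 1, [e2] that of the unmatched s =
   n term of the last sum. *)
have e1 : (n.+1 * n.+1 + 'C(n.+2, 2))%N = pent n.+1%:Z.
  have := pentE n.+1%:Z; have := pentagonalE n.+1%:Z.
  by have := mul_bin_diag n.+2 1; rewrite /= bin1; nia.
have e2 : (n * n + 'C(n.+1, 2) + (n + n.+1))%N = pent (- n.+1%:Z).
  have := pentE (- n.+1%:Z); have := pentagonalE (- n.+1%:Z).
  by have := mul_bin_diag n.+1 1; rewrite /= bin1; nia.
rewrite /shanks_term !big_geq // !mulr1 e1 -mulrA -exprD e2.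
rewrite !expN1r abszN /= -!mul_polyC rmorphXn rmorphN1 exprS.
by ring.
Qed.

(** * Comparison of coefficients up to a given degree *)

Definition coef_eq_upto (R : nzRingType) (N : nat) (p q : {poly R}) : Prop :=
  forall i, (i <= N)%N -> p`_i = q`_i.

Lemma coef_eq_uptoMl (R : nzRingType) N (r p q : {poly R}) :
  coef_eq_upto N p q -> coef_eq_upto N (r * p) (r * q).
Proof.
move=> pq i iN; rewrite !coefM; apply: eq_bigr => j _.
by rewrite pq //; lia.
Qed.

Lemma coef_compN (p : {poly int}) i : (p \Po - 'X)`_i = (-1) ^+ i * p`_i.
Proof.
rewrite coef_comp_poly.
under eq_bigr => j _ do rewrite exprNn -signr_odd
   -(rmorph_sign (@polyC int)) coefCM coefXn.
case: (ltnP i (size p)) => ip.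
  rewrite (bigD1 (Ordinal ip)) //= eqxx big1 ?addr0 => [|j].
    by rewrite mulr1 signr_odd mulrC.
  by rewrite -val_eqE /= eq_sym => /negbTE ->; rewrite !mulr0.
rewrite nth_default // mulr0 big1 // => j _.
by rewrite (gtn_eqF (leq_trans (ltn_ord j) ip)) !mulr0.
Qed.

(** In [shanks] the term s = 0 is the product, and every other term is divisible by ['X^(N.+1)]. *)
Lemma euler_prod_sum N : coef_eq_upto N (euler_prod N) (euler_sum N).
Proof.
move=> i iN; rewrite -shanks big_ord_recl coefD coef_sum big1 ?addr0.
  by rewrite /shanks_term /= expr0 mul1r mul0n bin_small // expr0 mulr1.
move=> s _; rewrite /shanks_term coefMXn ifT // lift0 binS bin1 mulSn.
lia.
Qed.

(** * Generating function of overpartitions into odd parts *)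

Definition oddover_gf (N c : nat) : {poly int} :=
  \poly_(i < N.+1) (num_oddover c i)%:Z.

Lemma coef_oddover_gf N c i : (i <= N)%N ->
  (oddover_gf N c)`_i = (num_oddover c i)%:Z.
Proof. by move=> iN; rewrite coef_poly ltnS iN. Qed.

Lemma oddover_gf_even N a : ~~ odd a -> (0 < a)%N ->
  coef_eq_upto N (oddover_gf N a.*2.+1) (oddover_gf N a.*2.-1).
Proof.
move=> oa a0 i iN; rewrite !coef_oddover_gf // num_oddover_rec; last lia.
have -> : a.*2.+1./2 = a by lia.
rewrite (negbTE oa) addn0 num_oddover_rec /=; last by lia.
by rewrite doubleK (negbTE oa) addn0.
Qed.

(** Code 2a + 1 is the overlined [a], used at most once; what follows it has codes at most 2a. *)
Lemma oddover_gf_overlined N a : odd a ->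
  coef_eq_upto N (oddover_gf N a.*2.+1) ((1 + 'X^a) * oddover_gf N a.*2).
Proof.
move=> oa i iN; rewrite mulrDl mul1r coefD coefXnM !coef_oddover_gf //; last lia.
rewrite num_oddover_rec /=; last lia.
have -> : uphalf a.*2 = a by lia.
by rewrite oa; case: leqP; rewrite ?addr0 ?addn0 // PoszD.
Qed.

(** Code 2a is the plain [a], which may repeat: removing one copy leaves the bound 2a unchanged,
    giving a geometric factor. *)
Lemma oddover_gf_plain N a : odd a ->
  coef_eq_upto N ((1 - 'X^a) * oddover_gf N a.*2) (oddover_gf N a.*2.-1).
Proof.
move=> oa i iN; rewrite mulrBl mul1r coefB coefXnM !coef_oddover_gf //; last lia.
rewrite (num_oddover_rec i (c := a.*2)) /=; last lia.
by rewrite doubleK oa; case: leqP; rewrite ?addn0 ?subr0 // PoszD addrK.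
Qed.

(** Each odd size [a] contributes (1 + q^a)/(1 - q^a); the denominators are cleared to stay within
    polynomials. *)
Lemma oddover_gf_prod N A :
  coef_eq_upto N (\prod_(1 <= j < A.+1 | odd j) (1 - 'X^j) * oddover_gf N A.*2.+1)
                 (\prod_(1 <= j < A.+1 | odd j) (1 + 'X^j)).
Proof.
elim: A => [|A IH] i iN.
  rewrite !big_geq // mul1r coef_oddover_gf // num_oddover_small // coef1.
  by case: (i == 0%N).
have recr (F : nat -> {poly int}) : \prod_(1 <= j < A.+2 | odd j) F j =
    \prod_(1 <= j < A.+1 | odd j) F j * (if odd A.+1 then F A.+1 else 1).
  by rewrite !(big_mkcond odd) big_nat_recr.
rewrite !recr; case: ifP => oA; last first.
  rewrite !mulr1 -(IH i iN); apply: coef_eq_uptoMl iN.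
  by apply: oddover_gf_even; rewrite ?oA.
set D := \prod_(1 <= j < A.+1 | odd j) (1 - 'X^j).
set U := \prod_(1 <= j < A.+1 | odd j) (1 + 'X^j).
rewrite (coef_eq_uptoMl _ (oddover_gf_overlined oA) iN).
(* Regrouped so that the left side of [oddover_gf_plain] is a right-hand factor, as [coef_eq_uptoMl]
   requires. *)
have -> : D * (1 - 'X^(A.+1)) * ((1 + 'X^(A.+1)) * oddover_gf N A.+1.*2) =
  (1 + 'X^(A.+1)) * D * ((1 - 'X^(A.+1)) * oddover_gf N A.+1.*2) by ring.
rewrite (coef_eq_uptoMl _ (oddover_gf_plain oA) iN) -mulrA [U * _]mulrC.
exact: coef_eq_uptoMl IH _ iN.
Qed.

(** * The substitution of -q for q and the convolution *)

Lemma euler_prod_odd_even n :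
  euler_prod n = \prod_(1 <= j < n.+1 | ~~ odd j) (1 - 'X^j) *
                 \prod_(1 <= j < n.+1 | odd j) (1 - 'X^j).
Proof. by rewrite mulrC /euler_prod (bigID odd). Qed.

Lemma euler_prod_compN n :
  euler_prod n \Po - 'X = \prod_(1 <= j < n.+1 | ~~ odd j) (1 - 'X^j) *
                          \prod_(1 <= j < n.+1 | odd j) (1 + 'X^j).
Proof.
rewrite mulrC /euler_prod rmorph_prod (bigID odd) /=.
congr (_ * _); apply: eq_bigr => j oj.
all: rewrite rmorphB rmorph1 rmorphXn /= comp_polyX exprNn -signr_odd.
  by rewrite oj expr1 mulN1r opprK.
by rewrite (negbTE oj) expr0 mul1r.
Qed.

(** The bound 2n + 1 admits all odd parts up to [n], so the odd factors of [euler_prod n] turn from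
    1 - q^j into 1 + q^j. *)
Lemma euler_sum_oddover_gf n :
  (euler_sum n * oddover_gf n n.*2.+1)`_n = (-1) ^+ n * (euler_sum n)`_n.
Proof.
rewrite -(euler_prod_sum (leqnn n)) -coef_compN euler_prod_compN.
rewrite mulrC -(coef_eq_uptoMl _ (@euler_prod_sum n) (leqnn n)).
rewrite mulrC euler_prod_odd_even -mulrA.
exact: coef_eq_uptoMl (@oddover_gf_prod n n) _ (leqnn n).
Qed.

Lemma pbar_odd_convolution (n : nat) :
  \sum_(k \in [set: int]%classic)
     ((-1) ^ k * (pbar_oddz (n%:Z - pentagonal k))%:Z)
  = (-1) ^+ n * \sum_(k <- zball n) (-1) ^ k * (n == pent k)%:R.
Proof.
rewrite (fsbigE (zball n)) ?zball_uniq //; last first.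
  (* Outside [zball n] the argument of [pbar_oddz] is negative, where its value is 0. *)
  move=> k _; rewrite mem_zball => kn.
  have : n%:Z - pentagonal k < 0 by have := ler_abs_pentagonal k; lia.
  by case: (_ - _) => //= _ _; rewrite mulr0.
under eq_bigl do rewrite in_setT.
transitivity (euler_sum n * oddover_gf n n.*2.+1)`_n.
  rewrite /euler_sum mulr_suml coef_sum; apply: eq_bigr => k _.
  rewrite -scalerAl coefZ coefXnM; congr (_ * _).
  rewrite -pentE; case: ltnP => nk.
    have : n%:Z - (pent k)%:Z < 0 by lia.
    by case: (_ - _).
  rewrite subzn //= coef_oddover_gf ?leq_subr //.
  by rewrite (@pbar_odd_num n.*2.+1) //; lia.
rewrite euler_sum_oddover_gf /euler_sum coef_sum; congr (_ * _).
by apply: eq_bigr => k _; rewrite coefZ coefXn.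
Qed.

Theorem theorem1p3 (n : nat) :
  (forall m : int, n%:Z = pentagonal m ->
     \sum_(k \in [set: int]%classic)
       ((-1) ^ k * (pbar_oddz (n%:Z - pentagonal k))%:Z)
     = (-1) ^ Num.ceil (m%:Q / 2)) /\
  (~ (exists m : int, n%:Z = pentagonal m) ->
     \sum_(k \in [set: int]%classic)
       ((-1) ^ k * (pbar_oddz (n%:Z - pentagonal k))%:Z)
     = 0).
Proof.
rewrite pbar_odd_convolution; split=> [m nm|nex].
  have mn : m \in zball n.
    by rewrite mem_zball nm ler_abs_pentagonal.
  have en : n = pent m by have := pentE m; lia.
  (* By injectivity of [pentagonal], only k = m contributes. *)
  rewrite (bigD1_seq m) ?zball_uniq //= en eqxx mulr1 big1 ?addr0.
    by rewrite exprnP pentE mulrC pentagonal_sign.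
  move=> k km; case: eqP => [e|]; rewrite ?mulr0 //.
  case/negP: km; apply/eqP/pentagonal_inj.
  by rewrite -!pentE e.
rewrite big1 ?mulr0 // => k _; case: eqP => [e|]; rewrite ?mulr0 //.
by case: nex; exists k; rewrite e pentE.
Qed.
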